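(* Let $G$ be a finite connected even graph, let $\mathcal{C}$ be a cycle decomposition of $G$, and let $CI(G)$ be the cycle intersection graph of $G$ with respect to $\mathcal{C}$. If $CI(G)$ is a path with $|E(CI(G))|=n$, then $\nabla(G)=\left\lceil\frac{n+1}{2}\right\rceil$.
   Context: An even graph is a graph in which every vertex has even degree (multiple edges are allowed). A cycle decomposition of $G$ is a collection of cycles of $G$ whose edge sets partition $E(G)$. The cycle intersection graph $CI(G)$ with respect to $\mathcal{C}$ is the (multi)graph with vertex set $\mathcal{C}$ having, for each pair of distinct cycles $C,C'\in\mathcal{C}$ and each vertex $v\in V(C)\cap V(C')$, one edge joining $C$ and $C'$. A decycling set of $G$ is a set $S\subseteq V(G)$ with $G\setminus S$ acyclic; $\nabla(G)$ is the minimum size of a decycling set. *)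

(* Defs.v *)
From mathcomp Require Import all_boot.

Set Implicit Arguments.
Unset Strict Implicit.
Unset Printing Implicit Defensive.

(* Finite loopless multigraphs: parallel edges are distinct elements of
   [edge] with the same pair of endpoints. *)
Record mgraph := MGraph {
  vertex : finType;
  edge : finType;
  ends : edge -> {set vertex};
  card_ends : forall e, #|ends e| = 2 }.

Arguments ends {m} e.
Arguments card_ends {m} e.

Definition degree (G : mgraph) (v : vertex G) : nat :=
  #|[set e : edge G | v \in ends e]|.

Definition even_graph (G : mgraph) : Prop :=
  forall v : vertex G, ~~ odd (degree v).

Definition adjacent (G : mgraph) : rel (vertex G) :=
  fun x y => [exists e : edge G, ends e == [set x; y]].

Definition connected_graph (G : mgraph) : Prop :=
  0 < #|vertex G| /\ forall x y : vertex G, connect (@adjacent G) x y.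

(* A cycle is represented by its edge set.  Since the edges of the closed walk
   v_0 e_0 v_1 e_1 ... v_(k-1) e_(k-1) v_0 are distinct, its length k is the
   number of edges of the cycle; [ordS] is the successor modulo k.  A pair of
   parallel edges is a cycle of length 2. *)
Definition is_cycle (G : mgraph) (C : {set edge G}) : bool :=
  (1 < #|C|) &&
  [exists vs : {ffun 'I_#|C| -> vertex G},
   exists es : {ffun 'I_#|C| -> edge G},
    [&& injectiveb vs, injectiveb es,
        [forall i, ends (es i) == [set vs i; vs (ordS i)]]
      & C == [set es i | i : 'I_#|C|]]].

Definition cycle_vertices (G : mgraph) (C : {set edge G}) : {set vertex G} :=
  \bigcup_(e in C) ends e.

Definition acyclic (G : mgraph) : bool :=
  [forall C : {set edge G}, ~~ is_cycle C].

Definition cycle_decomposition (G : mgraph) (CC : {set {set edge G}}) : Prop :=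
  (forall C, C \in CC -> is_cycle C) /\ partition CC [set: edge G].

Section CycleIntersectionGraph.

Variables (G : mgraph) (CC : {set {set edge G}}).

Definition CI_vertex : finType := {C : {set edge G} | C \in CC}.

(* One edge for each unordered pair of distinct members of [CC] and each
   vertex of G common to them. *)
Definition CI_edge : finType :=
  {p : {set CI_vertex} * vertex G |
     (#|p.1| == 2) && [forall C in p.1, p.2 \in cycle_vertices (val C)]}.

Definition CI_ends (x : CI_edge) : {set CI_vertex} := (val x).1.

Lemma card_CI_ends (x : CI_edge) : #|CI_ends x| = 2.
Proof. by case/andP: (valP x) => /eqP. Qed.

Definition CI : mgraph := MGraph card_CI_ends.

End CycleIntersectionGraph.

(* The one-vertex graph is a path without edges. *)
Definition is_path (G : mgraph) : Prop :=
  exists (k : nat) (vs : 'I_k.+1 -> vertex G) (es : 'I_k -> edge G),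
    [/\ bijective vs, bijective es
      & forall i : 'I_k,
          ends (es i) = [set vs (widen_ord (leqnSn k) i); vs (lift ord0 i)]].

Section VertexDeletion.

Variables (G : mgraph) (S : {set vertex G}).

Definition del_vertex : finType := {v : vertex G | v \notin S}.

Definition del_edge : finType := {e : edge G | [disjoint ends e & S]}.

Definition del_ends (e : del_edge) : {set del_vertex} :=
  [set v : del_vertex | val v \in ends (val e)].

Lemma card_del_ends (e : del_edge) : #|del_ends e| = 2.
Proof.
rewrite -(card_ends (val e)) -(card_imset _ val_inj); apply: eq_card => v.
apply/imsetP/idP => [[u + ->]|ve]; first by rewrite inE.
have vS : v \notin S by rewrite (disjointFr (valP e) ve).
by exists (exist _ v vS); rewrite ?inE.
Qed.

Definition del_vertices : mgraph := MGraph card_del_ends.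

End VertexDeletion.

Definition decycling_set (G : mgraph) (S : {set vertex G}) : bool :=
  acyclic (del_vertices S).

Lemma decycling_setT (G : mgraph) : decycling_set [set: vertex G].
Proof.
apply/forallP => C; apply/negP => /andP[C1 /existsP[vs _]].
by have := valP (vs (Ordinal (ltnW C1))); rewrite inE.
Qed.

(* [setT] is only the starting point of the search; it is a decycling set by
   [decycling_setT], so the minimum is attained at a decycling set. *)
Definition nabla (G : mgraph) : nat :=
  #|[arg min_(S < [set: vertex G] | decycling_set S) #|S|]|.

Lemma nablaP (G : mgraph) :
  (exists2 S : {set vertex G}, decycling_set S & #|S| = nabla G) /\
  (forall S : {set vertex G}, decycling_set S -> nabla G <= #|S|).
Proof.
rewrite /nabla; case: arg_minnP => [|S dS minS]; first exact: decycling_setT.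
by split; first by exists S.
Qed.

(* Main.v *)
Require Import Defs.
From mathcomp Require Import all_boot.

Set Implicit Arguments.
Unset Strict Implicit.
Unset Printing Implicit Defensive.

(** Let [c 0, ..., c n] be the cycles of the decomposition in path order and
    [w i] the unique common vertex of [c i] and [c i.+1].  The cycles
    [c 0, c 2, c 4, ...] are vertex-disjoint and each must meet a decycling set,
    which is the lower bound.  Conversely, let [D] be any cycle of [G], and [i]
    least such that [D] uses an edge of [c i].  Then [D] can leave [c i] only
    through [w i], and going once around [c i] from [w i] shows that [D]
    contains [c i].  Hence a set of vertices meeting every [c i] is decycling,
    and [w 0, w 2, w 4, ...] (with any vertex of [c n] as [w n]) is such a
    set. *)

(** Frees the length from the index type ['I_#|C|], so that a cycle can be built or taken apart with
    any [k]. *)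
Lemma is_cycleP (G : mgraph) (C : {set edge G}) :
  reflect (exists k (vs : 'I_k -> vertex G) (es : 'I_k -> edge G),
             [/\ 1 < k, injective vs, injective es,
                 forall i, ends (es i) = [set vs i; vs (ordS i)]
               & C = [set es i | i : 'I_k]])
          (is_cycle C).
Proof.
apply: (iffP andP) => [[C1 /existsP[vs /existsP[es]]]|].
  case/and4P=> /injectiveP vs_inj /injectiveP es_inj /forallP ends_es /eqP defC.
  by exists #|C|, vs, es; split=> // i; apply/eqP.
case=> k [vs [es [k1 vs_inj es_inj ends_es defC]]].
have cardC : #|C| = k by rewrite defC card_imset // card_ord.
rewrite cardC; split=> //.
apply/existsP; exists (finfun vs); apply/existsP; exists (finfun es).
apply/and4P; split.
- by apply/injectiveP=> i j; rewrite !ffunE => /vs_inj.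
- by apply/injectiveP=> i j; rewrite !ffunE => /es_inj.
- by apply/forallP=> i; rewrite !ffunE ends_es.
- by rewrite defC; apply/eqP/eq_imset => i; rewrite ffunE.
Qed.

Lemma ordS_neq k (i : 'I_k) : 1 < k -> ordS i != i.
Proof.
move=> k1; apply/eqP=> /(congr1 val) /=.
have := ltn_ord i; rewrite leq_eqVlt => /predU1P[ik|ik]; last first.
  by rewrite modn_small // => /eqP; rewrite eqn_leq ltnn.
by rewrite ik modnn => i0; rewrite -ik -i0 in k1.
Qed.

Lemma cycle_no_leaf (G : mgraph) (C : {set edge G}) e v :
  is_cycle C -> e \in C -> v \in ends e ->
  exists2 e', e' \in C & e' != e /\ v \in ends e'.
Proof.
case/is_cycleP=> k [vs [es [k1 vs_inj es_inj ends_es ->]]] /imsetP[i _ ->].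
rewrite ends_es => /set2P[]->.
  exists (es (ord_pred i)); first exact: imset_f.
  rewrite ends_es ord_predK set22 (inj_eq es_inj); split=> //.
  by rewrite -{2}[i]ord_predK eq_sym ordS_neq.
exists (es (ordS i)); first exact: imset_f.
by rewrite ends_es set21 (inj_eq es_inj) ordS_neq.
Qed.

Lemma cycle_neq0 (G : mgraph) (C : {set edge G}) :
  is_cycle C -> exists e, e \in C.
Proof. by case/andP=> C1 _; apply/card_gt0P; apply: ltnW. Qed.

Lemma cycle_vertices_neq0 (G : mgraph) (C : {set edge G}) :
  is_cycle C -> exists v, v \in cycle_vertices C.
Proof.
case/cycle_neq0=> e eC; have /card_gt0P[v ve] : 0 < #|ends e| by rewrite card_ends.
by exists v; apply/bigcupP; exists e.
Qed.

(** Cutting the cyclic order after [j0] leaves a linear order ending at [j0], along which [P] never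
    changes. *)
Lemma ordS_const k (P : pred 'I_k) (j0 : 'I_k) :
  (forall j, j != j0 -> P j = P (ordS j)) -> forall j, P j = P j0.
Proof.
move=> PS.
have up m (j : 'I_k) : j0 - j = m -> j <= j0 -> P j = P j0.
  elim: m j => [|m IHm] j dj le_j.
    by congr P; apply/val_inj/eqP; rewrite eqn_leq le_j -subn_eq0 dj.
  have lt_j : j < j0 by rewrite -subn_gt0 dj.
  have Sj : ordS j = j.+1 :> nat by rewrite /= modn_small // (leq_ltn_trans lt_j).
  rewrite PS; last by rewrite neq_ltn lt_j.
  by apply: IHm; rewrite Sj // subnS dj.
(* An index beyond [j0] climbs to [k - 1] and wraps around to 0, where [up] takes over. *)
have down m (j : 'I_k) : k - j = m -> P j = P j0.
  elim: m j => [|m IHm] j dj.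
    by move/eqP: dj; rewrite subn_eq0 leqNgt ltn_ord.
  have [le_j|lt_j] := leqP j j0; first exact: up le_j.
  rewrite PS; last by rewrite neq_ltn lt_j orbT.
  have := ltn_ord j; rewrite leq_eqVlt => /predU1P[jk|jk].
    by apply: up (erefl _) _; rewrite /= jk modnn.
  by apply: IHm; rewrite /= modn_small // subnS dj.
by move=> j; apply: down.
Qed.

(* The hypothesis says that [C :&: D] has no leaf except possibly at [w]. *)
Lemma cycle_sub (G : mgraph) (C D : {set edge G}) (w : vertex G) :
    is_cycle C ->
    (forall e v, e \in C -> e \in D -> v \in ends e -> v != w ->
       exists2 e', e' \in C /\ e' \in D & e' != e /\ v \in ends e') ->
  (exists2 e, e \in C & e \in D) -> C \subset D.
Proof.
case/is_cycleP=> k [vs [es [k1 vs_inj es_inj ends_es defC]]] leaf.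
have esC i : es i \in C by rewrite defC imset_f.
(* The only edges of [C] at [vs (ordS j)] are [es j] and [es (ordS j)], so away from [w] the leaf
   condition passes membership in [D] from either one to the other. *)
have step j : vs (ordS j) != w -> (es j \in D) = (es (ordS j) \in D).
  move=> vw; apply/idP/idP => eD.
    have [|e' []] := leaf _ (vs (ordS j)) (esC j) eD _ vw.
      by rewrite ends_es set22.
    rewrite {1}defC => /imsetP[j' _ ->] e'D []; rewrite (inj_eq es_inj) ends_es.
    move=> neq_j /set2P[/vs_inj->//|/vs_inj/ordS_inj eq_j].
    by rewrite eq_j eqxx in neq_j.
  have [|e' []] := leaf _ (vs (ordS j)) (esC (ordS j)) eD _ vw.
    by rewrite ends_es set21.
  rewrite {1}defC => /imsetP[j' _ ->] e'D []; rewrite (inj_eq es_inj) ends_es.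
  move=> neq_j /set2P[/vs_inj eq_j|/vs_inj/ordS_inj->//].
  by rewrite eq_j eqxx in neq_j.
case=> e; rewrite {1}defC => /imsetP[i _ ->{e}] eD.
(* The walk visits [w] at most once; if it never does, any index serves as [j0]. *)
have [j0 j0P] : exists j0, forall j, j != j0 -> vs (ordS j) != w.
  have [j0 /eqP <-|now] := pickP (fun j => vs (ordS j) == w).
    exists j0 => j; apply: contraNneq => /vs_inj/ordS_inj->.
    exact: eqxx.
  by exists i => j _; rewrite now.
have const := ordS_const (fun j jj0 => step j (j0P j jj0)).
apply/subsetP=> e; rewrite defC => /imsetP[j _ ->].
by rewrite const -(const i).
Qed.

(** A cycle avoiding [S] would survive, vertex by vertex and edge by edge, in the graph with [S]
    deleted. *)
Lemma decycling_set_meets (G : mgraph) (S : {set vertex G}) (C : {set edge G}) :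
  decycling_set S -> is_cycle C -> exists2 v, v \in S & v \in cycle_vertices C.
Proof.
move=> /forallP dS /is_cycleP[k [vs [es [k1 vs_inj es_inj ends_es defC]]]].
have [v /andP[]|disj] := pickP (fun v => (v \in S) && (v \in cycle_vertices C)).
  by exists v.
have vsC i : vs i \in cycle_vertices C.
  by apply/bigcupP; exists (es i); rewrite ?defC ?imset_f // ends_es set21.
have vsS i : vs i \notin S by have := disj (vs i); rewrite /= vsC andbT => ->.
have esS i : [disjoint ends (es i) & S].
  rewrite disjoint_subset ends_es; apply/subsetP=> v.
  by case/set2P=> ->; apply: vsS.
pose vs' i : vertex (del_vertices S) := exist _ (vs i) (vsS i).
pose es' i : edge (del_vertices S) := exist _ (es i) (esS i).
have /negP[] := dS [set es' i | i : 'I_k].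
apply/is_cycleP; exists k, vs', es'; split=> // [i j [/vs_inj]|i j [/es_inj]|i] //.
by apply/setP=> v; rewrite !inE ends_es !inE -!val_eqE.
Qed.

(** Carries a surviving cycle back to [G], keeping just what the covering argument uses: it is
    nonempty, avoids [S] and has no leaf. *)
Lemma not_decycling_set (G : mgraph) (S : {set vertex G}) :
  ~~ decycling_set S ->
  exists D : {set edge G},
    [/\ exists e, e \in D, forall e, e \in D -> [disjoint ends e & S]
      & forall e v, e \in D -> v \in ends e ->
          exists2 e', e' \in D & e' != e /\ v \in ends e'].
Proof.
rewrite negb_forall => /existsP[C /negPn cycC].
exists [set val e | e in C]; split.
- by have [e eC] := cycle_neq0 cycC; exists (val e); apply: imset_f.
- by move=> _ /imsetP[e _ ->]; apply: (valP e).
move=> _ v /imsetP[e eC ->] ve.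
have vS : v \notin S by rewrite (disjointFr (valP e) ve).
have [|e' e'C [neq_e]] := @cycle_no_leaf _ C e (exist _ v vS) cycC eC.
  by rewrite inE.
by rewrite inE /= => ve'; exists (val e'); rewrite ?imset_f.
Qed.

(* For [i < n], [w i] is the vertex shared by [c i] and [c i.+1]; [w n] is an
   arbitrary vertex of the last cycle. *)
Record cycle_chain (G : mgraph) (CC : {set {set edge G}}) (n : nat)
    (c : nat -> {set edge G}) (w : nat -> vertex G) : Prop := CycleChain {
  chain_mem : forall i, i <= n -> c i \in CC;
  chain_onto : forall C, C \in CC -> exists2 i, i <= n & C = c i;
  chain_link : forall i, i <= n -> w i \in cycle_vertices (c i);
  chain_linkS : forall i, i < n -> w i \in cycle_vertices (c i.+1);
  chain_meet : forall i j v, i < j <= n ->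
    v \in cycle_vertices (c i) -> v \in cycle_vertices (c j) ->
    j = i.+1 /\ v = w i }.

(** A vertex shared by two cycles is itself an edge of [CI CC], and the path has exactly one edge
    for each consecutive pair and no others. *)
Lemma CI_path_chain (G : mgraph) (CC : {set {set edge G}}) :
  (forall C, C \in CC -> is_cycle C) -> is_path (CI CC) ->
  exists c w, cycle_chain CC #|edge (CI CC)| c w.
Proof.
move=> cycCC [n [vs [es [vs_bij es_bij ends_es]]]].
have -> : #|edge (CI CC)| = n by rewrite -(bij_eq_card es_bij) card_ord.
pose c i := val (vs (inord i)).
have [v0 v0P] : exists v, v \in cycle_vertices (c n).
  exact/cycle_vertices_neq0/cycCC/valP.
(* The vertex of [G] labelling the [i]-th edge of the path; from index [n] on, the default [v0] on
   the last cycle. *)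
pose w i := if insub i is Some j then (val (es j)).2 else v0.
have wE (j : 'I_n) : w j = (val (es j)).2 by rewrite /w valK.
have endsE (j : 'I_n) : (val (es j)).1 = [set vs (inord j); vs (inord j.+1)].
  have := ends_es j; rewrite /= /CI_ends => ->.
  by congr [set vs _; vs _]; apply/val_inj; rewrite /= inordK // ltnS // ltnW.
have linkP (j : 'I_n) (C : vertex (CI CC)) :
    C \in (val (es j)).1 -> w j \in cycle_vertices (val C).
  by move=> Cj; rewrite wE; have /andP[_ /forall_inP] := valP (es j); apply.
exists c, w; split.
- by move=> i _; apply: valP.
- move=> C CCC; case: vs_bij => rk _ rkK.
  exists (rk (exist _ C CCC)); first by rewrite -ltnS ltn_ord.
  by rewrite /c inord_val rkK.
- move=> i; rewrite leq_eqVlt => /predU1P[->|lt_i].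
    by rewrite /w insubF // ltnn.
  by apply: (linkP (Ordinal lt_i)); rewrite endsE set21.
- by move=> i lt_i; apply: (linkP (Ordinal lt_i)); rewrite endsE set22.
move=> i j v /andP[lt_ij le_jn] vi vj.
have vs_inj := bij_inj vs_bij.
pose p : {set vertex (CI CC)} := [set vs (inord i); vs (inord j)].
have xP : (#|p| == 2) && [forall C in p, v \in cycle_vertices (val C)].
  rewrite cards2 (inj_eq vs_inj) -val_eqE /= !inordK ?ltnS //; last first.
    exact: leq_trans (ltnW lt_ij) le_jn.
  rewrite neq_ltn lt_ij; apply/forall_inP => C /set2P[]->; [exact: vi | exact: vj].
(* The pair [(p, v)] is an edge of [CI CC], hence the [m]-th edge of the path; comparing ends with
   [i < j] leaves [i = m] and [j = m.+1]. *)
case: es_bij => rk _ rkK; set m : 'I_n := rk (exist _ (p, v) xP).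
have esm : es m = exist _ (p, v) xP by apply: rkK.
have vE : v = w m by rewrite wE esm.
have pE : p = [set vs (inord m); vs (inord m.+1)] by rewrite -endsE esm.
have le_i : i <= n by apply: leq_trans (ltnW lt_ij) le_jn.
have inordE a b : a <= n -> b <= n -> vs (inord a) = vs (inord b) -> a = b.
  by move=> le_a le_b /vs_inj/(congr1 val); rewrite /= !inordK.
have iP : vs (inord i) \in p by apply: set21.
have jP : vs (inord j) \in p by apply: set22.
move: iP jP; rewrite pE => /set2P iP /set2P jP.
have lt_m := ltn_ord m.
have {}iP : i = m \/ i = m.+1 by case: iP => [/inordE|/inordE] ->; auto; rewrite // ltnW.
have {}jP : j = m \/ j = m.+1 by case: jP => [/inordE|/inordE] ->; auto; rewrite // ltnW.
move: lt_ij; case: iP jP => [->|->] [->|->]; rewrite ?ltnn //.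
by rewrite ltnNge leqnSn.
Qed.

Lemma chain_cover_decycling (G : mgraph) (CC : {set {set edge G}}) n c w
    (S : {set vertex G}) :
  cycle_decomposition CC -> cycle_chain CC n c w ->
  (forall i, i <= n -> exists2 v, v \in S & v \in cycle_vertices (c i)) ->
  decycling_set S.
Proof.
move=> [cycCC /and3P[/eqP covCC _ _]] chain SP; apply: contraT.
case/not_decycling_set => D [[e0 e0D] DS leafD].
have edgeP e : exists2 i, i <= n & e \in c i.
  have : e \in cover CC by rewrite covCC inE.
  by case/bigcupP=> C /(chain_onto chain)[i le_i ->]; exists i.
have exi : exists i, (i <= n) && [exists e in D, e \in c i].
  have [i le_i e0i] := edgeP e0.
  by exists i; rewrite le_i; apply/exists_inP; exists e0.
case: (ex_minnP exi) => i /andP[le_i /exists_inP[e eD ei]] min_i.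
have sub_D : c i \subset D.
  apply: (@cycle_sub _ _ _ (w i)); [exact/cycCC/(chain_mem chain) | | by exists e].
  move=> {ei eD}e v ei eD ve v_neq.
  have [e' e'D [neq_e ve']] := leafD e v eD ve.
  have [m le_m e'm] := edgeP e'.
  (* The next edge [e'] of [D] at [v] lies in [c m] with [i <= m] by minimality; [i < m] would force
     [v = w i]. *)
  have : i <= m by apply: min_i; rewrite le_m; apply/exists_inP; exists e'.
  rewrite leq_eqVlt => /predU1P[im|lt_im]; first by exists e'; rewrite ?im.
  have [|||_ eq_v] := chain_meet chain (i := i) (j := m) (v := v).
  - by rewrite lt_im.
  - by apply/bigcupP; exists e.
  - by apply/bigcupP; exists e'.
  by rewrite eq_v eqxx in v_neq.
have [v vS /bigcupP[e' e'i ve']] := SP i le_i.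
by rewrite (disjointFr (DS e' (subsetP sub_D e' e'i)) ve') in vS.
Qed.

Theorem theorem3 (G : mgraph) (CC : {set {set edge G}}) (n : nat)
  (G_connected : connected_graph G)
  (G_even : even_graph G)
  (CC_decomposition : cycle_decomposition CC)
  (CI_path : is_path (CI CC))
  (CI_edges : #|edge (CI CC)| = n) :
  nabla G = uphalf n.+1.
Proof.
have [cycCC _] := CC_decomposition.
have [c [w]] := CI_path_chain cycCC CI_path; rewrite CI_edges => chain.
have [[S0 dS0 cardS0] nabla_min] := nablaP G.
(* The claimed value counts the even numbers from 0 to [n]. *)
have dblE j : (j < uphalf n.+1) = (j.*2 <= n) by rewrite uphalfE ltnS geq_half_double.
have dbl_le (j : 'I_(uphalf n.+1)) : j.*2 <= n by rewrite -dblE.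
apply/eqP; rewrite eqn_leq; apply/andP; split.
  pose S := [set w j.*2 | j : 'I_(uphalf n.+1)].
  have cardS : #|S| <= uphalf n.+1 by rewrite (leq_trans (leq_imset_card _ _)) ?card_ord.
  have wS j : j.*2 <= n -> w j.*2 \in S.
    by rewrite -dblE => le_j; apply/imsetP; exists (Ordinal le_j).
  have dS : decycling_set S.
    apply: (chain_cover_decycling CC_decomposition chain) => i.
    (* For odd [i], the cycle [c i] is met at its link with [c i.-1]; for even [i], at [w i]. *)
    rewrite -(odd_double_half i); case: (odd i) => le_i.
      by exists (w i./2.*2); [apply/wS/ltnW | exact: chain_linkS chain _ le_i].
    by exists (w i./2.*2); [apply: wS | exact: chain_link chain _ le_i].
  exact: leq_trans (nabla_min S dS) cardS.
have meets (j : 'I_(uphalf n.+1)) :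
    exists v, (v \in S0) && (v \in cycle_vertices (c j.*2)).
  have [v vS vj] := decycling_set_meets dS0 (cycCC _ (chain_mem chain (dbl_le j))).
  by exists v; rewrite vS.
pose f j := xchoose (meets j).
have f_lt (i j : 'I_(uphalf n.+1)) : i < j -> f i != f j.
  move=> lt_ij; apply/eqP=> eq_f.
  have /andP[_ fi] := xchooseP (meets i); have /andP[_ fj] := xchooseP (meets j).
  (* A common value would lie on two even-indexed cycles, making their indices consecutive, against
     parity. *)
  have [||+ _] := chain_meet chain (i := i.*2) (j := j.*2) (v := f i) _ fi.
  - by rewrite ltn_double lt_ij dbl_le.
  - by rewrite eq_f.
  by move/(congr1 odd); rewrite /= !odd_double.
have f_inj : injective f.
  move=> i j eq_f; apply/val_inj/eqP; have [/f_lt|/f_lt|//] := ltngtP i j.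
    by rewrite eq_f eqxx.
  by rewrite eq_f eqxx.
rewrite -cardS0 -[X in X <= _]card_ord -(card_imset _ f_inj); apply: subset_leq_card.
by apply/subsetP=> _ /imsetP[j _ ->]; have /andP[] := xchooseP (meets j).
Qed.
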